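(* The functors $\mathfrak{Bur}_t:\mathfrak{U}\boldsymbol{\beta}\to\mathbb{C}[t^{\pm1}]\text{-}\mathfrak{Mod}$ and $\mathfrak{TYM}_t:\mathfrak{U}\boldsymbol{\beta}\to\mathbb{C}[t^{\pm1}]\text{-}\mathfrak{Mod}$ are very strong polynomial functors of degree $1$.
   Context: $\mathbb{N}=\{0,1,2,\dots\}$. **The category $\mathfrak{U}\boldsymbol{\beta}$.** $\mathbf{B}_n$ is the braid group on $n$ strands with Artin generators $\sigma_1,\dots,\sigma_{n-1}$; $\mathbf{B}_0,\mathbf{B}_1$ are trivial; the product is also written $\circ$, read from right to left. The braid groupoid $\boldsymbol{\beta}$ has objects $\mathbb{N}$, $\mathrm{Hom}(n,n)=\mathbf{B}_n$ and no morphisms between distinct objects. It is strict monoidal with $n\natural m=n+m$ and juxtaposition of braids ($\sigma_i\natural id_m=\sigma_i$, $id_n\natural\sigma_j=\sigma_{n+j}$ in $\mathbf{B}_{n+m}$), unit $0$, braided by $b^{\boldsymbol{\beta}}_{n,m}=(\sigma_m\circ\cdots\circ\sigma_1)\circ\cdots\circ(\sigma_{n+m-1}\circ\cdots\circ\sigma_n)$ (a product of $n$ factors; the identity if $n=0$ or $m=0$). $\mathfrak{U}\boldsymbol{\beta}$ has objects $\mathbb{N}$; morphisms $n\to n'$ exist only for $n'\ge n$ and are classes $[n'-n,f]$, $f\in\mathbf{B}_{n'}$, where $[n'-n,f]=[n'-n,f']$ iff $f=f'\circ(g\natural id_n)$ for some $g\in\mathbf{B}_{n'-n}$. Composition: $[n''-n',g]\circ[n'-n,f]=[n''-n,g\circ(id_{n''-n'}\natural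 f)]$; identities $[0,id_n]$; $\sigma\in\mathbf{B}_n$ is identified with $[0,\sigma]$. Monoidal structure: $[m'-m,g]\natural[n'-n,f]=[(m'-m)+(n'-n),(g\natural f)\circ(id_{m'-m}\natural(b^{\boldsymbol{\beta}}_{m,n'-n})^{-1}\natural id_n)]$. The unit $0$ is initial; $\iota_k=[k,id_k]:0\to k$. **The functors.** Both functors send $n$ to $\mathbb{C}[t^{\pm1}]^{\oplus n}$ and send $[n'-n,id_{n'}]$ to the embedding of $\mathbb{C}[t^{\pm1}]^{\oplus n}$ as the last $n$ copies in $\mathbb{C}[t^{\pm1}]^{\oplus n'}$; on Artin generators $\sigma_i\in\mathbf{B}_n$ ($n\ge2$), $\mathfrak{Bur}_t(\sigma_i)=Id_{i-1}\oplus\begin{bmatrix}0&t\\1&1-t\end{bmatrix}\oplus Id_{n-i-1}$ and $\mathfrak{TYM}_t(\sigma_i)=Id_{i-1}\oplus\begin{bmatrix}0&t\\1&0\end{bmatrix}\oplus Id_{n-i-1}$; a general morphism $[n'-n,\sigma]=\sigma\circ[n'-n,id_{n'}]$ is sent to the composite. These assignments define functors on $\mathfrak{U}\boldsymbol{\beta}$. **Polynomiality.** Let $\mathbb{K}=\mathbb{C}[t^{\pm1}]$. For $k\in\mathbb{N}$, $\tau_k$ is the endofunctor of $\mathbf{Fct}(\mathfrak{U}\boldsymbol{\beta},\mathbb{K}\text{-}\mathfrak{Mod})$ (the category of functors) given by precomposition with $k\natural-$; $i_k:Id\to\tau_k$ is induced by $\iota_k:0\to k$; $\kappa_k=\ker(i_k)$,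 $\delta_k=\mathrm{coker}(i_k)$. $\mathcal{P}ol^{strong}_n=\{0\}$ for $n<0$, and for $n\ge0$, $F\in\mathcal{P}ol_n^{strong}$ iff $\delta_k(F)\in\mathcal{P}ol^{strong}_{n-1}$ for all $k$. $\mathcal{VP}ol_n=\{0\}$ for $n<0$, and for $n\ge0$, $F\in\mathcal{P}ol_n^{strong}$ is in $\mathcal{VP}ol_n$ iff $\kappa_k(F)=0$ and $\delta_k(F)\in\mathcal{VP}ol_{n-1}$ for all $k$. $F$ is very strong polynomial of degree $d$ if $d$ is the smallest natural number with $F\in\mathcal{VP}ol_d$. *)

(* Defs.v *)
From HB Require Import structures.
From mathcomp Require Import all_boot all_order all_algebra.
From mathcomp Require Import boolp reals complex.
From mathcomp Require Import ring zify.

Set Implicit Arguments.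
Unset Strict Implicit.
Unset Printing Implicit Defensive.
Import GRing.Theory.
Local Open Scope quotient_scope.
Local Open Scope group_scope.

(* The letter [(i, false)] is the Artin generator sigma_{i+1}, the letter
   [(i, true)] its inverse. *)
Definition letter (n : nat) : choiceType := ('I_n.-1 * bool)%type.
Definition word (n : nat) : choiceType := seq (letter n).

Inductive braid_rel (n : nat) : word n -> word n -> Prop :=
| BraidRefl u : braid_rel u u
| BraidSym u v : braid_rel u v -> braid_rel v u
| BraidTrans u v w : braid_rel u v -> braid_rel v w -> braid_rel u w
| BraidCat u u' v v' :
    braid_rel u u' -> braid_rel v v' -> braid_rel (u ++ v) (u' ++ v')
| BraidCancel i b : braid_rel [:: (i, b); (i, ~~ b)] [::]
| BraidFar (i j : 'I_n.-1) : i.+1 < j ->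
    braid_rel [:: (i, false); (j, false)] [:: (j, false); (i, false)]
| BraidBraid (i j : 'I_n.-1) : j = i.+1 :> nat ->
    braid_rel [:: (i, false); (j, false); (i, false)]
              [:: (j, false); (i, false); (j, false)].

Definition braid_eqb (n : nat) : rel (word n) :=
  fun u v => `[< braid_rel u v >].

Lemma braid_eqb_equiv n : equiv_class_of (@braid_eqb n).
Proof.
split=> [u|u v|v u w]; first exact/asboolP/BraidRefl.
- by apply/asboolP/asboolP; exact: BraidSym.
- by move=> /asboolP uv /asboolP vw; apply/asboolP/(BraidTrans uv vw).
Qed.

Canonical braid_equiv n := EquivRelPack (@braid_eqb_equiv n).
Canonical braid_encModRel n := defaultEncModRel (@braid_eqb n).

Definition braid (n : nat) := {eq_quot (@braid_eqb n)}.
HB.instance Definition _ n := EqQuotient.on (braid n).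
HB.instance Definition _ n := Choice.on (braid n).

Definition braid_of_word n (u : word n) : braid n := \pi_(braid n) u.

Lemma braid_of_wordP n (u v : word n) :
  braid_of_word u = braid_of_word v <-> braid_rel u v.
Proof.
split=> [/eqP|uv]; last apply/eqP; rewrite /braid_of_word piE.
  by move/asboolP.
exact/asboolP.
Qed.

Lemma repr_braid n (x : braid n) : braid_of_word (repr x) = x.
Proof. exact: reprK. Qed.

Lemma braid_repr n (u : word n) : braid_rel (repr (braid_of_word u)) u.
Proof. exact/braid_of_wordP/repr_braid. Qed.

Definition letter_inv n (l : letter n) : letter n := (l.1, ~~ l.2).
Definition word_inv n (u : word n) : word n := rev (map (@letter_inv n) u).

Lemma word_inv_cat n (u v : word n) :
  word_inv (u ++ v) = word_inv v ++ word_inv u.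
Proof. by rewrite /word_inv map_cat rev_cat. Qed.

Lemma word_invK n : involutive (@word_inv n).
Proof.
move=> u; rewrite /word_inv map_rev revK -map_comp map_id_in // => -[i b] _ /=.
by rewrite /letter_inv /= negbK.
Qed.

Lemma word_invV n (u : word n) : braid_rel (u ++ word_inv u) [::].
Proof.
elim: u => [|l u IHu]; first exact: BraidRefl.
rewrite -cat1s word_inv_cat catA -(catA [:: l]).
apply: BraidTrans (_ : braid_rel ([:: l] ++ [::] ++ [:: letter_inv l]) _).
  rewrite -(catA [:: l]); apply: BraidCat; first exact: BraidRefl.
  by apply: BraidCat => //; exact: BraidRefl.
by case: l => i b; exact: BraidCancel.
Qed.

Lemma word_invVl n (u : word n) : braid_rel (word_inv u ++ u) [::].
Proof. by rewrite -{2}(word_invK u); apply: word_invV. Qed.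

Lemma word_inv_rel n (u v : word n) :
  braid_rel u v -> braid_rel (word_inv u) (word_inv v).
Proof.
move=> uv.
apply: BraidTrans (_ : braid_rel (word_inv u ++ (v ++ word_inv v)) _).
  rewrite -{1}[word_inv u]cats0; apply: BraidCat; first exact: BraidRefl.
  exact/BraidSym/word_invV.
rewrite catA -{2}[word_inv v]cat0s; apply: BraidCat; last exact: BraidRefl.
apply: BraidTrans (word_invVl u).
by apply: BraidCat; [exact: BraidRefl | exact: BraidSym].
Qed.

Section BraidGroup.
Variable n : nat.

Definition braid_one : braid n := braid_of_word [::].
Definition braid_mul (x y : braid n) : braid n :=
  braid_of_word (repr x ++ repr y).
Definition braid_inv (x : braid n) : braid n :=
  braid_of_word (word_inv (repr x)).

Lemma braid_mulE (u v : word n) :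
  braid_mul (braid_of_word u) (braid_of_word v) = braid_of_word (u ++ v).
Proof. by apply/braid_of_wordP/BraidCat; exact: braid_repr. Qed.

Lemma braid_invE (u : word n) :
  braid_inv (braid_of_word u) = braid_of_word (word_inv u).
Proof. by apply/braid_of_wordP/word_inv_rel/braid_repr. Qed.

Lemma braid_mulA : associative braid_mul.
Proof.
move=> x y z; rewrite -(repr_braid x) -(repr_braid y) -(repr_braid z).
by rewrite !braid_mulE catA.
Qed.

Lemma braid_mul1 : left_id braid_one braid_mul.
Proof. by move=> x; rewrite -(repr_braid x) braid_mulE. Qed.

Lemma braid_mulr1 : right_id braid_one braid_mul.
Proof. by move=> x; rewrite -(repr_braid x) braid_mulE cats0. Qed.

Lemma braid_mulV : left_inverse braid_one braid_inv braid_mul.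
Proof.
move=> x; rewrite -(repr_braid x) braid_invE braid_mulE.
exact/braid_of_wordP/word_invVl.
Qed.

Lemma braid_mulrV : right_inverse braid_one braid_inv braid_mul.
Proof.
move=> x; rewrite -(repr_braid x) braid_invE braid_mulE.
exact/braid_of_wordP/word_invV.
Qed.

HB.instance Definition _ := isGroup.Build (braid n)
  braid_mulA braid_mul1 braid_mulr1 braid_mulV braid_mulrV.

End BraidGroup.

Lemma braid_of_word_cat n (u v : word n) :
  braid_of_word (u ++ v) = braid_of_word u * braid_of_word v.
Proof. by rewrite -braid_mulE. Qed.

Lemma braid_of_word_inv n (u : word n) :
  braid_of_word (word_inv u) = (braid_of_word u)^-1.
Proof. by rewrite -braid_invE. Qed.

(* [sigma n i] is the Artin generator sigma_i of the braid group on [n]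
   strands for [1 <= i < n], and the identity for any other [i]. *)
Definition sigma (n i : nat) : braid n :=
  if i is j.+1 then
    if insub j is Some k then braid_of_word [:: (k, false)] else 1
  else 1.
Arguments sigma : simpl never.

Lemma sigmaE n (k : 'I_n.-1) : sigma n k.+1 = braid_of_word [:: (k, false)].
Proof. by rewrite /sigma valK. Qed.

Lemma sigma_default n i : n <= i -> sigma n i = 1.
Proof. by case: i => // i ni; rewrite /sigma insubN //; lia. Qed.

Variant sigma_spec (n i : nat) : braid n -> Prop :=
| SigmaGen (k : 'I_n.-1) of i = k.+1 :> nat :
    sigma_spec i (braid_of_word [:: (k, false)])
| SigmaOne of (i == 0)%N || (n <= i)%N : sigma_spec i 1.

Lemma sigmaP n i : sigma_spec i (sigma n i).
Proof.
case: i => [|i]; first exact: SigmaOne.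
have [lt_i|le_i] := ltnP i n.-1.
  by rewrite (sigmaE (Ordinal lt_i)); exact: SigmaGen.
by rewrite sigma_default; [apply: SigmaOne | ]; lia.
Qed.

Lemma sigma_far n i j : i.+1 < j -> commute (sigma n i) (sigma n j).
Proof.
move=> ij; rewrite /commute.
case: (sigmaP n i) => [k ik|_]; last by rewrite mul1g mulg1.
case: (sigmaP n j) => [l jl|_]; last by rewrite mul1g mulg1.
rewrite -!braid_of_word_cat.
by apply/braid_of_wordP/BraidFar; lia.
Qed.

Lemma sigma_braid n i : 0 < i -> i.+1 < n ->
  sigma n i * sigma n i.+1 * sigma n i
  = sigma n i.+1 * sigma n i * sigma n i.+1.
Proof.
move=> i0 lt_in.
case: (sigmaP n i) => [k ik|]; last lia.
case: (sigmaP n i.+1) => [l jl|]; last lia.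
rewrite -!braid_of_word_cat.
by apply/braid_of_wordP/BraidBraid; lia.
Qed.

Lemma braid_of_letter n (l : letter n) : braid_of_word [:: l] =
  if l.2 then (sigma n l.1.+1)^-1 else sigma n l.1.+1.
Proof.
case: l => i [] /=; rewrite sigmaE //.
by rewrite -braid_of_word_inv.
Qed.

Lemma braid_ind n (P : braid n -> Prop) : P 1 ->
  (forall i x, 0 < i < n -> P x -> P (sigma n i * x)) ->
  (forall i x, 0 < i < n -> P x -> P ((sigma n i)^-1 * x)) ->
  forall x, P x.
Proof.
move=> P1 PM PV x; rewrite -(repr_braid x); elim: (repr x) => //= l u IHu.
rewrite -cat1s braid_of_word_cat braid_of_letter.
by case: l => [i []] /=; [apply: PV | apply: PM] => //; have := ltn_ord i; lia.
Qed.

(* Evaluation of a braid in a monoid [(T, op, idx)]: sigma_{i+1} is sent to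
   [f i], its inverse to [g i]. *)
Definition braid_eval n (T : Type) (idx : T) (op : T -> T -> T)
    (f g : 'I_n.-1 -> T) (x : braid n) : T :=
  \big[op/idx]_(l <- repr x) (if l.2 then g l.1 else f l.1).

Section BraidEval.
Variables (n : nat) (T : Type) (idx : T) (op : Monoid.law idx).
Variables f g : 'I_n.-1 -> T.
Hypothesis fgK : forall i, op (f i) (g i) = idx.
Hypothesis gfK : forall i, op (g i) (f i) = idx.
Hypothesis f_far : forall i j : 'I_n.-1, i.+1 < j ->
  op (f i) (f j) = op (f j) (f i).
Hypothesis f_braid : forall i j : 'I_n.-1, j = i.+1 :> nat ->
  op (f i) (op (f j) (f i)) = op (f j) (op (f i) (f j)).

Local Notation wev u := (\big[op/idx]_(l <- u) (if l.2 then g l.1 else f l.1)).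

Lemma braid_eval_rel (u v : word n) : braid_rel u v -> wev u = wev v.
Proof.
elim=> {u v} //= [u v w _ -> _ -> //|u u' v v' _ eu _ ev|i b|i j ij|i j ij].
- by rewrite !big_cat /= eu ev.
- by rewrite !big_cons big_nil /= Monoid.mulm1; case: b; rewrite /= ?fgK ?gfK.
- by rewrite !big_cons !big_nil /= !Monoid.mulm1 f_far.
- by rewrite !big_cons !big_nil /= !Monoid.mulm1 f_braid.
Qed.

Local Notation ev := (braid_eval idx op f g).

Lemma braid_evalE u : ev (braid_of_word u) = wev u.
Proof. exact/braid_eval_rel/braid_repr. Qed.

Lemma braid_eval1 : ev 1 = idx.
Proof. by rewrite -[1]/(braid_of_word [::]) braid_evalE big_nil. Qed.

Lemma braid_evalM x y : ev (x * y) = op (ev x) (ev y).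
Proof.
rewrite -(repr_braid x) -(repr_braid y) -braid_of_word_cat.
by rewrite !braid_evalE big_cat.
Qed.

Lemma braid_eval_sigma (i : 'I_n.-1) : ev (sigma n i.+1) = f i.
Proof. by rewrite sigmaE braid_evalE big_seq1. Qed.

End BraidEval.

(* For [a + m <= n], [strands a m n x] is the braid [id_a] juxtaposed with
   [x], juxtaposed with [id_(n - a - m)]: sigma_i is sent to sigma_{a+i}. *)
Definition strands (a m n : nat) (x : braid m) : braid n :=
  braid_eval 1 *%g (fun i : 'I_m.-1 => sigma n (a + i.+1))
    (fun i : 'I_m.-1 => (sigma n (a + i.+1))^-1) x.
Arguments strands : clear implicits.
Arguments strands a m n x : rename.

Definition juxtapose (m n : nat) (x : braid m) (y : braid n) : braid (m + n) :=
  strands 0 m (m + n) x * strands m n (m + n) y.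

Section Strands.
Variables (a m n : nat) (amn : a + m <= n).

Let sfar (i j : 'I_m.-1) : i.+1 < j ->
  sigma n (a + i.+1) * sigma n (a + j.+1)
  = sigma n (a + j.+1) * sigma n (a + i.+1).
Proof. by move=> ij; apply: sigma_far; lia. Qed.

Let sbraid (i j : 'I_m.-1) : j = i.+1 :> nat ->
  sigma n (a + i.+1) * (sigma n (a + j.+1) * sigma n (a + i.+1))
  = sigma n (a + j.+1) * (sigma n (a + i.+1) * sigma n (a + j.+1)).
Proof.
move=> ij; have -> : (a + j.+1 = (a + i.+1).+1)%N by lia.
by rewrite !mulgA sigma_braid //; have := ltn_ord j; lia.
Qed.

Lemma strands1 : strands a m n 1 = 1.
Proof.
by rewrite /strands braid_eval1 // => i; rewrite /= ?mulgV ?mulVg.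
Qed.

Lemma strandsM x y : strands a m n (x * y) = strands a m n x * strands a m n y.
Proof.
by rewrite /strands braid_evalM // => i; rewrite /= ?mulgV ?mulVg.
Qed.

Lemma strands_sigma i : 0 < i < m -> strands a m n (sigma m i) = sigma n (a + i).
Proof.
case: i => // i lt_i; have lt_i' : i < m.-1 by lia.
rewrite (sigmaE (Ordinal lt_i')) -sigmaE /strands braid_eval_sigma //.
  by move=> j; rewrite /= mulgV.
by move=> j; rewrite /= mulVg.
Qed.

Lemma strandsV x : strands a m n x^-1 = (strands a m n x)^-1.
Proof. by apply/(mulgI (strands a m n x)); rewrite -strandsM !mulgV strands1. Qed.

End Strands.

Lemma strands_id n x : strands 0 n n x = x.
Proof.
elim/braid_ind: x => [|i x lt_i IHx|i x lt_i IHx]; first by rewrite strands1.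
  by rewrite strandsM // strands_sigma // IHx.
by rewrite strandsM // strandsV // strands_sigma // IHx.
Qed.

Lemma strands_comp a b l m n x : a + m <= n -> b + l <= m ->
  strands a m n (strands b l m x) = strands (a + b) l n x.
Proof.
move=> amn blm; have abn : a + b + l <= n by lia.
have E i : 0 < i < l -> strands a m n (sigma m (b + i)) = sigma n (a + b + i).
  by move=> lt_i; rewrite strands_sigma ?addnA //; lia.
elim/braid_ind: x => [|i x lt_i IHx|i x lt_i IHx]; first by rewrite !strands1.
  by rewrite !strandsM // (strands_sigma blm) // (strands_sigma abn) // E // IHx.
by rewrite !strandsM // !strandsV // (strands_sigma blm) // (strands_sigma abn) // E // IHx.
Qed.

Lemma commute_gen n l (y : braid n) (P : nat -> braid n) (Q : braid l -> braid n) :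
  Q 1 = 1 -> (forall u v, Q (u * v) = Q u * Q v) ->
  (forall i, 0 < i < l -> Q (sigma l i) = P i) ->
  (forall i, 0 < i < l -> commute y (P i)) ->
  forall x, commute y (Q x).
Proof.
move=> Q1 QM QP yP.
have QV u : Q u^-1 = (Q u)^-1.
  by apply/(mulgI (Q u)); rewrite -QM !mulgV Q1.
elim/braid_ind=> [|i x lt_i IHx|i x lt_i IHx]; rewrite ?Q1 ?QM ?QV ?QP //.
- exact: commute1.
- apply: commuteM => //; exact: yP.
- by apply: commuteM => //; apply/commuteV/yP.
Qed.

Lemma strands_commute a b l m n x y : a + l <= b -> b + m <= n ->
  commute (strands a l n x) (strands b m n y).
Proof.
move=> alb bmn; have aln : a + l <= n by lia.
apply: (commute_gen (P := fun i => sigma n (b + i))).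
- exact: strands1.
- exact: strandsM.
- by move=> i; apply: strands_sigma.
move=> i lt_i; apply/commute_sym.
apply: (commute_gen (P := fun i => sigma n (a + i))).
- exact: strands1.
- exact: strandsM.
- by move=> j; apply: strands_sigma.
by move=> j lt_j; apply/commute_sym/sigma_far; lia.
Qed.

(* [sigma_run N j m] is sigma_{m+j} o ... o sigma_{1+j}. *)
Definition sigma_run (N j m : nat) : braid N :=
  \prod_(i < m) sigma N (m + j - i).

Definition braiding (n m : nat) : braid (n + m) :=
  \prod_(j < n) sigma_run (n + m) j m.

Lemma sigma_runS N j m :
  sigma_run N j m.+1 = sigma N (m.+1 + j) * sigma_run N j m.
Proof.
by rewrite /sigma_run big_ord_recl /= subn0.
Qed.

Lemma sigma_run_cat N j p q :
  sigma_run N j (q + p) = sigma_run N (q + j) p * sigma_run N j q.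
Proof.
elim: p => [|p IHp]; first by rewrite addn0 [sigma_run N (q + j) 0]big_ord0 mul1g.
by rewrite addnS !sigma_runS IHp mulgA; congr (sigma _ _ * _ * _); lia.
Qed.

Lemma sigma_run_commute N j m x :
  (forall i, j < i <= m + j -> commute x (sigma N i)) ->
  commute x (sigma_run N j m).
Proof.
move=> xi; rewrite /sigma_run; elim/big_rec: _ => [|i y _ IHy].
  exact: commute1.
by apply: commuteM => //; apply: xi; have := ltn_ord i; lia.
Qed.

Lemma sigma_run_shift N j m i : 0 < i < m -> m + j < N ->
  sigma_run N j m * sigma N (i + j).+1 = sigma N (i + j) * sigma_run N j m.
Proof.
move=> lt_i mjN.
have Em : m = (i.-1 + (2 + (m - i.+1)))%N by lia.
rewrite Em !sigma_run_cat.
set A := sigma_run _ _ (m - _); set B := sigma_run _ _ 2.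
set C := sigma_run _ _ i.-1.
have EB : B = sigma N (i + j).+1 * sigma N (i + j).
  rewrite /B !sigma_runS [sigma_run _ _ 0]big_ord0 mulg1.
  by congr (sigma _ _ * sigma _ _); lia.
have CC : commute (sigma N (i + j).+1) C.
  by apply: sigma_run_commute => l lt_l; apply/commute_sym/sigma_far; lia.
have CA : commute (sigma N (i + j)) A.
  by apply: sigma_run_commute => l lt_l; apply/sigma_far; lia.
rewrite -!mulgA -CC !mulgA CA -!(mulgA A); congr (A * _).
congr (_ * C).
by rewrite EB !mulgA -sigma_braid //; lia.
Qed.

Lemma strands_run a m n j l : a + m <= n -> l + j < m ->
  strands a m n (sigma_run m j l) = sigma_run n (a + j) l.
Proof.
move=> amn; elim: l => [|l IHl] lt_l.
  by rewrite /sigma_run !big_ord0 strands1.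
rewrite !sigma_runS strandsM // IHl ?strands_sigma //; try lia.
by congr (sigma _ _ * _); lia.
Qed.

Lemma strands_prod a m n (amn : a + m <= n) (r : nat) (F : 'I_r -> braid m) :
  strands a m n (\prod_(j < r) F j) = \prod_(j < r) strands a m n (F j).
Proof. exact: (big_morph _ (strandsM amn) (strands1 amn)). Qed.

Lemma strands_braiding a n m N : a + (n + m) <= N ->
  strands a (n + m) N (braiding n m) = \prod_(j < n) sigma_run N (a + j) m.
Proof.
move=> le_N; rewrite strands_prod //; apply: eq_bigr => j _.
by rewrite strands_run //; have := ltn_ord j; lia.
Qed.

Lemma run_prod_shift N r m i : 0 < i < m -> m + r <= N ->
  (\prod_(j < r) sigma_run N j m) * sigma N (i + r)
  = sigma N i * \prod_(j < r) sigma_run N j m.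
Proof.
move=> lt_i; elim: r => [|r IHr] le_N.
  by rewrite big_ord0 mul1g mulg1 addn0.
rewrite big_ord_recr /= -mulgA addnS sigma_run_shift //; try lia.
by rewrite mulgA IHr; [rewrite mulgA | lia].
Qed.

(* Naturality of the braiding in its second argument. *)
Lemma braiding_nat k p (g : braid p) :
  braiding k p * strands k p (k + p) g = strands 0 p (k + p) g * braiding k p.
Proof.
have le1 : 0 + p <= k + p by lia.
have E i : 0 < i < p ->
    braiding k p * sigma (k + p) (k + i) = sigma (k + p) i * braiding k p.
  by move=> lt_i; rewrite (addnC k i) /braiding run_prod_shift //; lia.
elim/braid_ind: g => [|i x lt_i IHx|i x lt_i IHx].
- by rewrite !strands1 // mulg1 mul1g.
- rewrite !strandsM // !strands_sigma // add0n.
  by rewrite mulgA E // -!mulgA IHx.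
- rewrite !strandsM // !strandsV // !strands_sigma // add0n.
  apply: (mulgI (sigma (k + p) i)); rewrite !mulgA mulgV mul1g -E //.
  by rewrite -(mulgA _ (sigma _ _)) mulgV mulg1.
Qed.

Lemma run_prod_cat N r p q :
  \prod_(j < r) sigma_run N j (q + p)
  = (\prod_(j < r) sigma_run N (q + j) p) * \prod_(j < r) sigma_run N j q.
Proof.
elim: r => [|r IHr]; first by rewrite !big_ord0 mulg1.
rewrite !big_ord_recr /= IHr sigma_run_cat !mulgA; congr (_ * _).
rewrite -!mulgA; congr (_ * _).
apply/commute_sym/commute_prod => j _.
apply: sigma_run_commute => i lt_i; apply/commute_sym.
apply: sigma_run_commute => l lt_l; apply: sigma_far.
by have := ltn_ord j; lia.
Qed.

(* Hexagon identity for the braiding. *)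
Lemma braiding_cat k q p :
  strands 0 (k + (q + p)) (k + (q + p)) (braiding k (q + p))
  = strands q (k + p) (k + (q + p)) (braiding k p)
    * strands 0 (k + q) (k + (q + p)) (braiding k q).
Proof. by rewrite !strands_braiding ?run_prod_cat //; lia. Qed.

(* Representatives of the morphisms [n -> n'], which exist only if [n <= n']. *)
Definition upre (n n' : nat) : choiceType := {f : braid n' | n <= n'}.

(* In [f' = f o (g natural id_n)], [g natural id_n] is
   [strands 0 (n' - n) n' g]. *)
Definition upre_eqb (n n' : nat) : rel (upre n n') := fun f f' =>
  `[< exists g : braid (n' - n), sval f = sval f' * strands 0 (n' - n) n' g >].

Lemma upre_eqb_equiv n n' : equiv_class_of (@upre_eqb n n').
Proof.
rewrite /upre_eqb; split=> [f|f f'|f f' h].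
- by apply/asboolP; exists 1; rewrite strands1 ?mulg1 //; lia.
- by apply/asboolP/asboolP => -[g ->]; exists g^-1;
    rewrite strandsV ?mulgK //; lia.
move=> /asboolP[g fg] /asboolP[g' f'g']; apply/asboolP.
by exists (g' * g); rewrite strandsM ?mulgA -?f'g' //; lia.
Qed.

Canonical upre_equiv n n' := EquivRelPack (@upre_eqb_equiv n n').
Canonical upre_encModRel n n' := defaultEncModRel (@upre_eqb n n').

Definition uhom (n n' : nat) := {eq_quot (@upre_eqb n n')}.

(* The morphism [[n' - n, f]]. *)
Definition uclass n n' (le_n : n <= n') (f : braid n') : uhom n n' :=
  \pi_(uhom n n') (exist _ f le_n : upre n n').

Definition urepr n n' (f : uhom n n') : braid n' := sval (repr f).

Lemma uhom_le n n' (f : uhom n n') : n <= n'.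
Proof. by case: (repr f). Qed.

Lemma uclassP n n' (le_n le_n' : n <= n') (f f' : braid n') :
  uclass le_n f = uclass le_n' f' <->
  exists g : braid (n' - n), f = f' * strands 0 (n' - n) n' g.
Proof.
split=> [/eqP|ff']; last apply/eqP; rewrite /uclass piE.
  by move/asboolP.
exact/asboolP.
Qed.

Lemma ureprK n n' (le_n : n <= n') (f : uhom n n') : uclass le_n (urepr f) = f.
Proof.
rewrite -[RHS]reprK /uclass /urepr; congr (\pi _).
by case: (repr f) => x le_n' /=; congr exist; apply: bool_irrelevance.
Qed.

Lemma urepr_class n n' (le_n : n <= n') (f : braid n') :
  exists g : braid (n' - n),
    urepr (uclass le_n f) = f * strands 0 (n' - n) n' g.
Proof. by apply/(uclassP le_n le_n); rewrite ureprK. Qed.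

Lemma uhomW n n' (P : uhom n n' -> Prop) :
  (forall le_n f, P (uclass le_n f)) -> forall f, P f.
Proof. by move=> Pc f; rewrite -(ureprK (uhom_le f) f). Qed.

Definition uid (n : nat) : uhom n n := uclass (leqnn n) 1.

Definition ucomp n n' n'' (g : uhom n' n'') (f : uhom n n') : uhom n n'' :=
  uclass (leq_trans (uhom_le f) (uhom_le g))
    (urepr g * strands (n'' - n') n' n'' (urepr f)).

Lemma ucompE n n' n'' (le_n : n <= n') (le_n' : n' <= n'')
    (g : braid n'') (f : braid n') :
  ucomp (uclass le_n' g) (uclass le_n f)
  = uclass (leq_trans le_n le_n') (g * strands (n'' - n') n' n'' f).
Proof.
apply/uclassP; have [h ->] := urepr_class le_n f.
have [l ->] := urepr_class le_n' g.
rewrite strandsM ?strands_comp; try lia.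
exists (strands 0 (n'' - n') (n'' - n) l * strands (n'' - n') (n' - n) (n'' - n) h).
rewrite strandsM ?strands_comp; try lia.
rewrite addn0 -!mulgA; congr (_ * _); rewrite !mulgA add0n; congr (_ * _).
by apply: strands_commute; lia.
Qed.

Lemma ucomp1f n n' (f : uhom n n') : ucomp (uid n') f = f.
Proof.
elim/uhomW: f => le_n f; rewrite ucompE mul1g subnn strands_id.
by apply/uclassP; exists 1; rewrite strands1 ?mulg1 //; lia.
Qed.

Lemma ucompf1 n n' (f : uhom n n') : ucomp f (uid n) = f.
Proof.
elim/uhomW: f => le_n f; rewrite ucompE strands1 ?mulg1; last lia.
by apply/uclassP; exists 1; rewrite strands1 ?mulg1 //; lia.
Qed.

Lemma ucompA n n' n'' n''' (h : uhom n'' n''') (g : uhom n' n'')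
    (f : uhom n n') : ucomp h (ucomp g f) = ucomp (ucomp h g) f.
Proof.
elim/uhomW: h => le_h h; elim/uhomW: g => le_g g; elim/uhomW: f => le_f f.
rewrite !ucompE; apply/uclassP; exists 1.
rewrite strands1 ?mulg1; last lia.
rewrite strandsM ?strands_comp ?mulgA; try lia.
have le_n' := uhom_le (uclass le_f f); have le_h' := uhom_le (uclass le_h h).
by have -> : (n''' - n' = n''' - n'' + (n'' - n'))%N by lia.
Qed.

Lemma utensor_le m m' n n' (g : uhom m m') (f : uhom n n') :
  m + n <= m' + n'.
Proof. exact: leq_add (uhom_le g) (uhom_le f). Qed.

(* [strands] turns the inverse braiding into
   [id_(m' - m) natural b^-1 natural id_n]. *)
Definition utensor m m' n n' (g : uhom m m') (f : uhom n n') :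
    uhom (m + n) (m' + n') :=
  uclass (utensor_le g f)
    (juxtapose (urepr g) (urepr f)
     * strands (m' - m) (m + (n' - n)) (m' + n') (braiding m (n' - n))^-1).

Lemma urepr_id n : urepr (uid n) = 1.
Proof.
have [g ->] := urepr_class (leqnn n) 1.
rewrite mul1g; elim/braid_ind: g => [|i x|i x]; rewrite ?strands1 //; lia.
Qed.

Lemma utensor_idE k n n' (le_n : n <= n') (le_kn : k + n <= k + n')
    (f : braid n') :
  utensor (uid k) (uclass le_n f) = uclass le_kn
    (strands k n' (k + n') f
     * (strands 0 (k + (n' - n)) (k + n') (braiding k (n' - n)))^-1).
Proof.
apply/uclassP; have [h ->] := urepr_class le_n f.
rewrite /juxtapose urepr_id strands1 ?mul1g; last lia.
rewrite subnn strandsV; last lia.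
rewrite strandsM ?strands_comp; try lia.
set p := (n' - n)%N in h *; set N := (k + n')%N.
exists (strands 0 p (N - (k + n)) h).
rewrite strands_comp; try lia.
rewrite -!mulgA; congr (_ * _); rewrite addn0.
set b := strands _ _ _ (braiding k p).
apply: (mulgI b); apply: (mulIg b); rewrite !mulgA mulgVK mulgV mul1g.
have := congr1 (strands 0 (k + p) N) (braiding_nat k h).
by rewrite !strandsM ?strands_comp; try lia; move=> ->.
Qed.

Lemma utensor_id1 k n : utensor (uid k) (uid n) = uid (k + n).
Proof.
rewrite (utensor_idE (leqnn n) (leqnn (k + n))).
apply/uclassP; exists 1; rewrite !strands1 ?mul1g ?mulg1; try lia.
rewrite subnn strands_braiding; last lia.
rewrite big1 ?invg1 // => j _; exact: big_ord0.
Qed.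

Lemma utensor_idM k n n' n'' (g : uhom n' n'') (f : uhom n n') :
  utensor (uid k) (ucomp g f) = ucomp (utensor (uid k) g) (utensor (uid k) f).
Proof.
elim/uhomW: g => le_g g; elim/uhomW: f => le_f f.
have le_kf : k + n <= k + n' by rewrite leq_add2l.
have le_kg : k + n' <= k + n'' by rewrite leq_add2l.
rewrite ucompE (utensor_idE _ (leq_trans le_kf le_kg)).
rewrite (utensor_idE _ le_kf) (utensor_idE _ le_kg) ucompE.
apply/uclassP; exists 1; rewrite strands1 ?mulg1; last lia.
rewrite !strandsM ?strandsV ?strands_comp; try lia.
set N := (k + n'')%N; set q := (n'' - n')%N; set p := (n' - n)%N.
have -> : (n'' - n = q + p)%N by lia.
have -> : (N - (k + n') = q)%N by lia.
rewrite addn0 -!mulgA; congr (_ * _).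
have := congr1 (strands 0 (k + (q + p)) N) (braiding_cat k q p).
rewrite strandsM ?strands_comp; try lia.
rewrite !add0n => ->; rewrite invgM !mulgA; congr (_ * _).
rewrite (addnC q k).
apply/commuteV/commute_sym/strands_commute; lia.
Qed.


Definition iota_mor (k : nat) : uhom 0 k := uclass (leq0n k) 1.

Lemma utensor_iotaE k n (le_n : n <= k + n) :
  utensor (iota_mor k) (uid n) = uclass le_n 1.
Proof.
apply/uclassP; rewrite /juxtapose urepr_id [strands k n _ _]strands1 ?mulg1 //.
have [h ->] := urepr_class (leq0n k) 1; rewrite mul1g.
have le_k : (k - 0 <= k + n - n)%N by lia.
exists (strands 0 (k - 0) (k + n - n) (strands 0 (k - 0) (k - 0) h)).
rewrite !strands_comp ?mul1g; try lia.
rewrite (_ : (braiding _ _)^-1 = 1) ?strands1 ?mulg1 //; try lia.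
by rewrite /braiding big_ord0 invg1.
Qed.

Lemma utensor_iota_nat k n n' (f : uhom n n') :
  ucomp (utensor (uid k) f) (utensor (iota_mor k) (uid n))
  = ucomp (utensor (iota_mor k) (uid n')) f.
Proof.
elim/uhomW: f => le_f f.
have le_k a : a <= k + a by rewrite leq_addl.
have le_kf : k + n <= k + n' by rewrite leq_add2l.
rewrite !(utensor_iotaE (le_k _)) (utensor_idE le_f le_kf) !ucompE.
apply/uclassP; rewrite strands1 ?mulg1 ?mul1g; last lia.
have le_p : 0 + (k + (n' - n)) <= k + n' - n by lia.
exists (strands 0 (k + (n' - n)) (k + n' - n) (braiding k (n' - n)))^-1.
rewrite strandsV ?strands_comp; try lia.
by rewrite (_ : k + n' - n' = k)%N; last lia.
Qed.

Local Close Scope group_scope.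
Local Open Scope ring_scope.

Record category := Category {
  ob :> Type;
  hom : ob -> ob -> Type;
  idm : forall a, hom a a;
  cmp : forall x y z, hom y z -> hom x y -> hom x z;
  cmp1m : forall a b (f : hom a b), cmp (idm b) f = f;
  cmpm1 : forall a b (f : hom a b), cmp f (idm a) = f;
  cmpA : forall a b c d (h : hom c d) (g : hom b c) (f : hom a b),
    cmp h (cmp g f) = cmp (cmp h g) f }.

Arguments hom {C} a b : rename.
Arguments idm {C} a : rename.
Arguments cmp {C x y z} g f : rename.

Record functor (C D : category) := Functor {
  fob :> C -> D;
  fmor : forall a b : C, hom a b -> hom (fob a) (fob b);
  fmor1 : forall a, fmor (idm a) = idm (fob a);
  fmorM : forall (a b c : C) (g : hom b c) (f : hom a b),
    fmor (cmp g f) = cmp (fmor g) (fmor f) }.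

Arguments fmor {C D} F {a b} f : rename.

Record nat_trans (C D : category) (F G : functor C D) := NatTrans {
  component :> forall a : C, hom (F a) (G a);
  naturality : forall (a b : C) (f : hom a b),
    cmp (fmor G f) (component a) = cmp (component b) (fmor F f) }.

Section Precomposition.
Variables (C C' D : category) (F : functor C' D) (T : functor C C').

Lemma precomp1 a : fmor F (fmor T (idm a)) = idm (F (T a)).
Proof. by rewrite !fmor1. Qed.

Lemma precompM (a b c : C) (g : hom b c) (f : hom a b) :
  fmor F (fmor T (cmp g f)) = cmp (fmor F (fmor T g)) (fmor F (fmor T f)).
Proof. by rewrite !fmorM. Qed.

Definition precomp : functor C D :=
  @Functor C D (fun a => F (T a)) (fun a b f => fmor F (fmor T f))
    precomp1 precompM.

End Precomposition.

Definition Ubeta : category :=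
  @Category nat uhom uid ucomp ucomp1f ucompf1 ucompA.

Section ModuleCategory.
Variable K : nzRingType.

Lemma linear_eqP (U V : lmodType K) (f g : {linear U -> V}) : f =1 g -> f = g.
Proof.
case: f => f cf; case: g => g cg /= /funext eq_fg.
case: _ / eq_fg in cg *; congr GRing.Linear.Pack.
case: cf cg => [[a1] [a2]] [[b1] [b2]].
by rewrite (Prop_irrelevance a1 b1) (Prop_irrelevance a2 b2).
Qed.

Definition mod_id (U : lmodType K) : {linear U -> U} := idfun.
Definition mod_comp (U V W : lmodType K) (g : {linear V -> W})
  (f : {linear U -> V}) : {linear U -> W} := g \o f.

Lemma mod_comp1m (U V : lmodType K) (f : {linear U -> V}) : mod_comp (mod_id V) f = f.
Proof. exact: linear_eqP. Qed.
Lemma mod_compm1 (U V : lmodType K) (f : {linear U -> V}) : mod_comp f (mod_id U) = f.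
Proof. exact: linear_eqP. Qed.
Lemma mod_compA (U V W X : lmodType K) (h : {linear W -> X}) (g : {linear V -> W})
  (f : {linear U -> V}) :
  mod_comp h (mod_comp g f) = mod_comp (mod_comp h g) f.
Proof. exact: linear_eqP. Qed.

Definition Mod : category :=
  @Category (lmodType K) (fun U V => {linear U -> V}) mod_id mod_comp
    mod_comp1m mod_compm1 mod_compA.

End ModuleCategory.

Section Kernel.
Variables (K : nzRingType) (U V : lmodType K) (f : {linear U -> V}).

Definition ker_pred : {pred U} := [pred x | f x == 0].

Lemma ker_pred_closed : submod_closed ker_pred.
Proof.
split=> [|a x y]; rewrite !inE ?linear0 // => /eqP fx /eqP fy.
by rewrite linearP fx fy scaler0 addr0.
Qed.

Record kernel := Kernel { kval : U; kvalP : kval \in ker_pred }.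

HB.instance Definition _ := [isSub for kval].
HB.instance Definition _ := [Choice of kernel by <:].
HB.instance Definition _ :=
  GRing.SubChoice_isSubLmodule.Build K U ker_pred kernel ker_pred_closed.

End Kernel.

Section Cokernel.
Variables (K : nzRingType) (U V : lmodType K) (f : {linear U -> V}).

Definition im_pred : {pred V} := [pred y | `[< exists x, y = f x >]].

Lemma im_predP y : reflect (exists x, y = f x) (y \in im_pred).
Proof. exact: asboolP. Qed.

Lemma im_pred_closed : zmod_closed im_pred.
Proof.
split=> [|x y]; first by apply/im_predP; exists 0; rewrite linear0.
move=> /im_predP[u ->] /im_predP[v ->]; apply/im_predP; exists (u - v).
by rewrite linearB.
Qed.

HB.instance Definition _ := GRing.isZmodClosed.Build V im_pred im_pred_closed.

Definition cokernel := Quotient.quot im_pred.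

HB.instance Definition _ := GRing.Zmodule.on cokernel.
HB.instance Definition _ := EqQuotient.on cokernel.

Definition coker_proj (x : V) : cokernel := \pi_cokernel x.

Lemma coker_projP x y :
  reflect (exists u, x - y = f u) (coker_proj x == coker_proj y).
Proof. by rewrite /coker_proj piE; apply: im_predP. Qed.

Lemma coker_proj_repr (q : cokernel) : coker_proj (repr q) = q.
Proof. exact: reprK. Qed.

Lemma coker_projD x y : coker_proj (x + y) = coker_proj x + coker_proj y.
Proof. by rewrite /coker_proj !piE. Qed.

Definition coker_scale (a : K) (q : cokernel) : cokernel :=
  coker_proj (a *: repr q).

Lemma coker_scaleE a x : coker_scale a (coker_proj x) = coker_proj (a *: x).
Proof.
apply/eqP/coker_projP; rewrite -scalerBr.
have /eqP/coker_projP[u ->] := coker_proj_repr (coker_proj x).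
by exists (a *: u); rewrite linearZ.
Qed.

Lemma coker_scaleA a b q :
  coker_scale a (coker_scale b q) = coker_scale (a * b) q.
Proof. by rewrite -(coker_proj_repr q) !coker_scaleE scalerA. Qed.

Lemma coker_scale1 : left_id 1 coker_scale.
Proof. by move=> q; rewrite -(coker_proj_repr q) coker_scaleE scale1r. Qed.

Lemma coker_scaleDr : right_distributive coker_scale +%R.
Proof.
move=> a p q; rewrite -(coker_proj_repr p) -(coker_proj_repr q).
by rewrite -coker_projD !coker_scaleE scalerDr coker_projD.
Qed.

Lemma coker_scaleDl q : {morph coker_scale^~ q : a b / a + b}.
Proof.
move=> a b; rewrite -(coker_proj_repr q).
by rewrite !coker_scaleE scalerDl coker_projD.
Qed.

HB.instance Definition _ := GRing.Zmodule_isLmodule.Build K cokernel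
  coker_scaleA coker_scale1 coker_scaleDr coker_scaleDl.

Lemma coker_proj_linear : linear coker_proj.
Proof. by move=> a x y; rewrite coker_projD -coker_scaleE. Qed.

HB.instance Definition _ :=
  GRing.isLinear.Build K V cokernel *:%R coker_proj coker_proj_linear.

End Cokernel.

Section FunctorKernel.
Variables (K : nzRingType) (C : category) (F G : functor C (Mod K)).
Variable phi : nat_trans F G.

Lemma phi_nat (a b : C) (f : hom a b) x :
  fmor G f (phi a x) = phi b (fmor F f x).
Proof. exact: (congr1 (fun h : {linear _ -> _} => h x) (naturality phi f)). Qed.

Lemma fmor1E (H : functor C (Mod K)) (a : C) x : fmor H (idm a) x = x.
Proof. by rewrite fmor1. Qed.

Lemma fmorME (H : functor C (Mod K)) (a b c : C) (g : hom b c) (f : hom a b) x :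
  fmor H (cmp g f) x = fmor H g (fmor H f x).
Proof. by rewrite fmorM. Qed.

(* Kernels and cokernels of natural transformations are computed objectwise. *)
Definition fker_ob (a : C) : lmodType K := kernel (phi a).

Lemma fker_mor_subproof (a b : C) (f : hom a b) (x : fker_ob a) :
  fmor F f (val x) \in ker_pred (phi b).
Proof.
by rewrite inE -phi_nat (eqP (valP x : val x \in ker_pred (phi a))) linear0.
Qed.

Definition fker_fun (a b : C) (f : hom a b) (x : fker_ob a) : fker_ob b :=
  Kernel (fker_mor_subproof f x).

Lemma fker_fun_linear a b f : linear (@fker_fun a b f).
Proof. by move=> c x y; apply: val_inj; rewrite /= linearP. Qed.

HB.instance Definition _ a b f := GRing.isLinear.Build K (fker_ob a) (fker_ob b)
  *:%R (@fker_fun a b f) (@fker_fun_linear a b f).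

Definition fker_mor (a b : C) (f : hom a b) : {linear fker_ob a -> fker_ob b} :=
  @fker_fun a b f.

Lemma fker_mor1 a : fker_mor (idm a) = mod_id (fker_ob a).
Proof. by apply: linear_eqP => x; apply: val_inj; rewrite /= fmor1E. Qed.

Lemma fker_morM (a b c : C) (g : hom b c) (f : hom a b) :
  fker_mor (cmp g f) = mod_comp (fker_mor g) (fker_mor f).
Proof. by apply: linear_eqP => x; apply: val_inj; rewrite /= fmorME. Qed.

Definition fker : functor C (Mod K) :=
  @Functor C (Mod K) fker_ob fker_mor fker_mor1 fker_morM.

Definition fcoker_ob (a : C) : lmodType K := cokernel (phi a).

Definition fcoker_fun (a b : C) (f : hom a b) (q : fcoker_ob a) : fcoker_ob b :=
  coker_proj (phi b) (fmor G f (repr q)).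

Lemma fcoker_funE (a b : C) (f : hom a b) x :
  fcoker_fun f (coker_proj (phi a) x) = coker_proj (phi b) (fmor G f x).
Proof.
apply/eqP/coker_projP; rewrite -linearB.
have /eqP/coker_projP[u ->] := coker_proj_repr (coker_proj (phi a) x).
by exists (fmor F f u); rewrite -phi_nat.
Qed.

Lemma fcoker_fun_linear a b f : linear (@fcoker_fun a b f).
Proof.
move=> c p q; rewrite -(coker_proj_repr p) -(coker_proj_repr q).
by rewrite -linearP !fcoker_funE !linearP.
Qed.

HB.instance Definition _ a b f := GRing.isLinear.Build K
  (fcoker_ob a) (fcoker_ob b) *:%R (@fcoker_fun a b f) (@fcoker_fun_linear a b f).

Definition fcoker_mor (a b : C) (f : hom a b) :
    {linear fcoker_ob a -> fcoker_ob b} := @fcoker_fun a b f.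

Lemma fcoker_mor1 a : fcoker_mor (idm a) = mod_id (fcoker_ob a).
Proof.
apply: linear_eqP => q; rewrite -(coker_proj_repr q) /=.
by rewrite fcoker_funE fmor1E.
Qed.

Lemma fcoker_morM (a b c : C) (g : hom b c) (f : hom a b) :
  fcoker_mor (cmp g f) = mod_comp (fcoker_mor g) (fcoker_mor f).
Proof.
apply: linear_eqP => q; rewrite -(coker_proj_repr q) /=.
by rewrite !fcoker_funE fmorME.
Qed.

Definition fcoker : functor C (Mod K) :=
  @Functor C (Mod K) fcoker_ob fcoker_mor fcoker_mor1 fcoker_morM.

End FunctorKernel.

Definition translation (k : nat) : functor Ubeta Ubeta :=
  @Functor Ubeta Ubeta (fun n : nat => (k + n)%N)
    (fun n n' (f : uhom n n') => utensor (uid k) f)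
    (utensor_id1 k) (@utensor_idM k).

Section Polynomial.
Variable K : nzRingType.
Implicit Type F : functor Ubeta (Mod K).

Definition tau (k : nat) F : functor Ubeta (Mod K) := precomp F (translation k).

(* [0 natural n] and [n] are convertible. *)
Definition i_component (k : nat) F (n : nat) : {linear F n -> tau k F n} :=
  fmor F (utensor (iota_mor k) (uid n) : @hom Ubeta n (k + n)%N).

Lemma i_naturality k F (n n' : nat) (f : uhom n n') :
  mod_comp (fmor (tau k F) f) (i_component k F n)
  = mod_comp (i_component k F n') (fmor F f).
Proof.
have E := @fmorM Ubeta (Mod K) F; rewrite /= in E.
by rewrite /i_component /= -!E utensor_iota_nat.
Qed.

Definition i_trans (k : nat) F : nat_trans F (tau k F) :=
  @NatTrans Ubeta (Mod K) F (tau k F) (i_component k F) (@i_naturality k F).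

Definition kappa (k : nat) F : functor Ubeta (Mod K) := fker (i_trans k F).
Definition delta (k : nat) F : functor Ubeta (Mod K) := fcoker (i_trans k F).

Definition is_zero F : Prop := forall (n : nat) (x : F n), x = 0.

(* The classes of negative degree consist of the zero functors; this is the
   [else] branch of the next two definitions. *)
Fixpoint strong_pol (d : nat) F : Prop := forall k,
  if d is d'.+1 then strong_pol d' (delta k F) else is_zero (delta k F).

Fixpoint very_strong_pol (d : nat) F : Prop := strong_pol d F /\ forall k,
  is_zero (kappa k F) /\
  if d is d'.+1 then very_strong_pol d' (delta k F) else is_zero (delta k F).

Definition very_strong_pol_of_degree (d : nat) F : Prop :=
  very_strong_pol d F /\ forall d', very_strong_pol d' F -> (d <= d')%N.

End Polynomial.

Section Laurent.
Variable F : fieldType.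
Local Notation frac := {fraction {poly F}}.
Local Notation "p %:F" := (@FracField.tofrac {poly F} p).

Definition laurent_pred : {pred frac} := [pred x |
  `[< exists (p : {poly F}) (n : nat), x = p%:F / ('X%:F) ^+ n >]].

Lemma laurent_predP x :
  reflect (exists (p : {poly F}) (n : nat), x = p%:F / ('X%:F) ^+ n)
    (x \in laurent_pred).
Proof. exact: asboolP. Qed.

Lemma fracX_neq0 : ('X : {poly F})%:F != 0 :> frac.
Proof. by rewrite tofrac_eq0 polyX_eq0. Qed.

Lemma laurent_pred_closed : subring_closed laurent_pred.
Proof.
have Xn m : ('X : {poly F})%:F ^+ m != 0 :> frac by rewrite expf_neq0 ?fracX_neq0.
split.
- by apply/laurent_predP; exists 1, 0%N; rewrite expr0 divr1 tofrac1.
- move=> x y /laurent_predP[p [m ->]] /laurent_predP[q [n ->]].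
  apply/laurent_predP; exists (p * 'X^n - q * 'X^m), (m + n)%N.
  by rewrite tofracB !tofracM !tofracXn exprD -mulNr addf_div ?Xn // mulNr.
- move=> x y /laurent_predP[p [m ->]] /laurent_predP[q [n ->]].
  apply/laurent_predP; exists (p * q), (m + n)%N.
  by rewrite tofracM exprD invfM mulrACA.
Qed.

(* The ring of Laurent polynomials over [F], as the subring of [F(X)] whose
   elements are the fractions [p / X^n]. *)
Record laurent := Laurent { lval : frac; lvalP : lval \in laurent_pred }.

HB.instance Definition _ := [isSub for lval].
HB.instance Definition _ := [Choice of laurent by <:].
HB.instance Definition _ :=
  GRing.SubChoice_isSubComNzRing.Build frac laurent_pred laurent
    laurent_pred_closed.

Lemma lvalM (x y : laurent) : lval (x * y) = lval x * lval y.
Proof. by []. Qed.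

Lemma lval1 : lval 1 = 1.
Proof. by []. Qed.

Definition laurent_unit : {pred laurent} :=
  [pred x | (lval x != 0) && ((lval x)^-1 \in laurent_pred)].
Definition laurent_inv (x : laurent) : laurent := 
  if x \in laurent_unit then insubd x (lval x)^-1 else x.

Lemma laurent_mulVx : {in laurent_unit, left_inverse 1 laurent_inv *%R}.
Proof.
move=> x ux; apply: val_inj; rewrite -[LHS]/(lval (laurent_inv x * x)).
rewrite lvalM /laurent_inv ux.
by move: ux => /andP[x0 xV]; rewrite -[lval (insubd _ _)]/(val _) insubdK // mulVf.
Qed.

Lemma laurent_unitPl (x y : laurent) : y * x = 1 -> x \in laurent_unit.
Proof.
move=> yx; have vyx : lval y * lval x = 1.
  by rewrite -lvalM yx lval1.
have x0 : lval x != 0.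
  by apply/eqP => x0; move/eqP: vyx; rewrite x0 mulr0 eq_sym oner_eq0.
rewrite inE x0 /=; suff -> : (lval x)^-1 = lval y by apply: lvalP.
by apply: (mulIf x0); rewrite mulVf.
Qed.

Lemma laurent_inv_out : {in [predC laurent_unit], laurent_inv =1 id}.
Proof. by move=> x; rewrite inE /laurent_inv => /negPf ->. Qed.

HB.instance Definition _ := GRing.ComNzRing_hasMulInverse.Build laurent
  laurent_mulVx laurent_unitPl laurent_inv_out.

Lemma laurentX_subproof : ('X : {poly F})%:F \in laurent_pred.
Proof. by apply/laurent_predP; exists 'X, 0%N; rewrite expr0 divr1. Qed.

Definition laurentX : laurent := Laurent laurentX_subproof.

Lemma laurentX_inv_subproof : ('X : {poly F})%:F^-1 \in laurent_pred.
Proof. by apply/laurent_predP; exists 1, 1%N; rewrite tofrac1 div1r expr1. Qed.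

Lemma laurentX_unit : laurentX \is a GRing.unit.
Proof.
apply/unitrPr; exists (Laurent laurentX_inv_subproof); apply: val_inj.
exact: (mulfV fracX_neq0).
Qed.

End Laurent.

Section MatrixFunctor.
Variable K : comUnitRingType.

Definition mx2 (a b c d : K) : 'M[K]_2 := \matrix_(i, j)
  if i == 0 then (if j == 0 then a else b) else (if j == 0 then c else d).

(* [Id_j (+) M (+) Id_(n - j - 2)] for [j.+1 < n]; rows and columns are
   numbered from 0. *)
Definition gen_mx (n : nat) (M : 'M[K]_2) (j : nat) : 'M[K]_n := \matrix_(r, c)
  if (j <= r <= j.+1)%N && (j <= c <= j.+1)%N
  then M (inord (r - j)) (inord (c - j)) else (r == c)%:R.

(* [gen_mx n M j] as an operator on column vectors. *)
Definition gen_act (M : 'M[K]_2) (j : nat) (x : nat -> K) (r : nat) : K :=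
  if r == j then M 0 0 * x j + M 0 1 * x j.+1
  else if r == j.+1 then M 1 0 * x j + M 1 1 * x j.+1 else x r.

Definition rowf m n (X : 'M[K]_(n, m)) (c : 'I_m) (r : nat) : K :=
  if insub r is Some r' then X r' c else 0.

Lemma rowfE m n (X : 'M[K]_(n, m)) c (r : 'I_n) : rowf X c r = X r c.
Proof. by rewrite /rowf valK. Qed.

Lemma rowf_inj m n (X Y : 'M[K]_(n, m)) :
  (forall c r, (r < n)%N -> rowf X c r = rowf Y c r) -> X = Y.
Proof. by move=> XY; apply/matrixP => r c; rewrite -!rowfE XY. Qed.

Lemma gen_mx_rowf m n M j (X : 'M[K]_(n, m)) c r : (j.+1 < n)%N -> (r < n)%N ->
  rowf (gen_mx n M j *m X) c r = gen_act M j (rowf X c) r.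
Proof.
move=> lt_j lt_r; have lt_j' : (j < n)%N by lia.
pose r0 := Ordinal lt_r; pose j0 := Ordinal lt_j'; pose j1 := Ordinal lt_j.
have -> : rowf (gen_mx n M j *m X) c r = (gen_mx n M j *m X) r0 c.
  exact: (rowfE _ _ r0).
rewrite /gen_act (rowfE X c j0 : rowf X c j = _).
rewrite (rowfE X c j1 : rowf X c j.+1 = _) (rowfE X c r0 : rowf X c r = _) mxE.
have i0 k : k = 0%N -> inord k = 0 :> 'I_2 by move=> ->; apply: val_inj; rewrite /= inordK.
have i1 k : k = 1%N -> inord k = 1 :> 'I_2 by move=> ->; apply: val_inj; rewrite /= inordK.
have j10 : j1 != j0 by apply/eqP => /(congr1 val) /=; lia.
have [rj|rj] := eqVneq r j; last have [rj1|rj1] := eqVneq r j.+1.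
- rewrite (bigD1 j0) //= (bigD1 j1) //= big1 ?addr0 => [|k /andP[k0 k1]].
    rewrite !mxE ifT /=; last lia.
    rewrite ifT; last lia.
    by rewrite (i0 (r - j)%N) ?(i0 (j - j)%N) ?(i1 (j.+1 - j)%N) //; lia.
  have kj0 : (k != j :> nat) by [].
  have kj1 : (k != j.+1 :> nat) by [].
  rewrite !mxE ifF /=; last lia.
  by rewrite -val_eqE /= rj eq_sym (negPf kj0) mul0r.
- rewrite (bigD1 j0) //= (bigD1 j1) //= big1 ?addr0 => [|k /andP[k0 k1]].
    rewrite !mxE ifT /=; last lia.
    rewrite ifT; last lia.
    by rewrite (i1 (r - j)%N) ?(i0 (j - j)%N) ?(i1 (j.+1 - j)%N) //; lia.
  have kj0 : (k != j :> nat) by [].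
  have kj1 : (k != j.+1 :> nat) by [].
  rewrite !mxE ifF /=; last lia.
  by rewrite -val_eqE /= rj1 eq_sym (negPf kj1) mul0r.
rewrite (bigD1 r0) //= big1 ?addr0 => [|k k0].
  by rewrite !mxE ifF /= ?eqxx ?mul1r //; lia.
rewrite !mxE ifF /=; last lia.
by rewrite eq_sym (negPf k0) mul0r.
Qed.

Lemma eq_gen_act M j x y r : x =1 y -> gen_act M j x r = gen_act M j y r.
Proof. by move=> xy; rewrite /gen_act !xy. Qed.

Lemma gen_act_rowf m n M j (X : 'M[K]_(n, m)) c r : (j.+1 < n)%N ->
  gen_act M j (rowf X c) r = rowf (gen_mx n M j *m X) c r.
Proof.
move=> lt_j; have [lt_r|le_r] := ltnP r n; first by rewrite gen_mx_rowf.
rewrite /gen_act !ifF; try lia.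
by rewrite /rowf !insubN // -leqNgt.
Qed.

Lemma gen_mx_far n M i j : (i.+1 < j)%N -> (j.+1 < n)%N ->
  gen_mx n M i *m gen_mx n M j = gen_mx n M j *m gen_mx n M i.
Proof.
move=> ij lt_j; have lt_i : (i.+1 < n)%N by lia.
rewrite -[gen_mx n M j in LHS]mulmx1 -[gen_mx n M i in RHS]mulmx1.
apply: rowf_inj => c r _; rewrite -!gen_act_rowf //.
set x := rowf 1%:M c.
rewrite (eq_gen_act _ _ _ (fun r => esym (gen_act_rowf M 1%:M c r lt_j))).
rewrite (eq_gen_act _ _ _ (fun r => esym (gen_act_rowf M 1%:M c r lt_i))).
rewrite /gen_act -/x.
have [ij' i1j' ij1' i1j1' ] : [/\ (i == j) = false, (i.+1 == j) = false,
  (i == j.+1) = false & (i.+1 == j.+1) = false] by split; lia.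
have [ji' j1i' ji1' j1i1' ] : [/\ (j == i) = false, (j.+1 == i) = false,
  (j == i.+1) = false & (j.+1 == i.+1) = false] by split; lia.
rewrite ij' i1j' ij1' i1j1' ji' j1i' ji1' j1i1'.
have [->|_] := eqVneq r i; first by rewrite ij' ij1'.
by have [->|_] := eqVneq r i.+1; first by rewrite i1j' i1j1'.
Qed.

(* The braid relation for [M] acting on rows 0, 1 and on rows 1, 2. *)
Definition yang_baxter (M : 'M[K]_2) : Prop := forall x r,
  gen_act M 0 (gen_act M 1 (gen_act M 0 x)) r
  = gen_act M 1 (gen_act M 0 (gen_act M 1 x)) r.

Lemma gen_act_shift M a j x r :
  gen_act M (a + j) x (a + r) = gen_act M j (fun i => x (a + i)%N) r.
Proof. by rewrite /gen_act -addnS !eqn_add2l. Qed.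

Lemma gen_mx_braid n M i : yang_baxter M -> (i.+2 < n)%N ->
  gen_mx n M i *m (gen_mx n M i.+1 *m gen_mx n M i)
  = gen_mx n M i.+1 *m (gen_mx n M i *m gen_mx n M i.+1).
Proof.
move=> YB lt_i1; have lt_i : (i.+1 < n)%N by lia.
apply: rowf_inj => c r _.
have E A j (lt_j : (j.+1 < n)%N) : rowf (gen_mx n M j *m A) c =1
    gen_act M j (rowf A c) by move=> l; rewrite -gen_act_rowf.
have E1 j (lt_j : (j.+1 < n)%N) : rowf (gen_mx n M j) c =1
    gen_act M j (rowf 1%:M c) by move=> l; rewrite -E // mulmx1.
rewrite !E //.
rewrite (eq_gen_act _ _ _ (E _ _ lt_i1)) (eq_gen_act _ _ _ (E _ _ lt_i)).
set x := rowf 1%:M c in E1.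
have -> : gen_act M i (gen_act M i.+1 (rowf (gen_mx n M i) c)) r
    = gen_act M i (gen_act M i.+1 (gen_act M i x)) r.
  by do 2!apply: eq_gen_act => ?; exact: E1.
have -> : gen_act M i.+1 (gen_act M i (rowf (gen_mx n M i.+1) c)) r
    = gen_act M i.+1 (gen_act M i (gen_act M i.+1 x)) r.
  by do 2!apply: eq_gen_act => ?; exact: E1.
have [lt_r|le_r] := ltnP r i.
  rewrite /gen_act; do !(rewrite ifF; last lia); done.
have S j y l :
    gen_act M (i + j) y (i + l) = gen_act M j (fun s => y (i + s)%N) l.
  exact: gen_act_shift.
have S3 j k l y s :
    gen_act M (i + j) (gen_act M (i + k) (gen_act M (i + l) y)) (i + s)
    = gen_act M j (gen_act M k (gen_act M l (fun u => y (i + u)%N))) s.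
  rewrite S; apply: eq_gen_act => u; rewrite S; apply: eq_gen_act => v.
  exact: S.
have := S3 0%N 1%N 0%N x (r - i)%N; have := S3 1%N 0%N 1%N x (r - i)%N.
by rewrite addn0 addn1 subnKC // => -> ->; apply: YB.
Qed.

Lemma gen_mx_mulV n M j : M \in unitmx -> (j.+1 < n)%N ->
  gen_mx n M j *m gen_mx n (invmx M) j = 1%:M.
Proof.
move=> uM lt_j; apply: rowf_inj => c r _; rewrite -gen_act_rowf //.
have E l : rowf (gen_mx n (invmx M) j) c l
    = gen_act (invmx M) j (rowf 1%:M c) l.
  by rewrite gen_act_rowf // mulmx1.
rewrite (eq_gen_act _ _ _ E); set x := rowf 1%:M c.
have MV a b : M a 0 * invmx M 0 b + M a 1 * invmx M 1 b = (a == b)%:R.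
  have := congr1 (fun A : 'M[K]_2 => A a b) (mulmxV uM).
  rewrite !mxE big_ord_recl big_ord1 => <-.
  by congr (_ * _ + M _ _ * invmx M _ _); apply: val_inj.
have jS : (j.+1 == j) = false by lia.
rewrite /gen_act eqxx jS eqxx.
have D a (u v : K) : M a 0 * (invmx M 0 0 * u + invmx M 0 1 * v)
    + M a 1 * (invmx M 1 0 * u + invmx M 1 1 * v)
    = (a == 0)%:R * u + (a == 1)%:R * v.
  by rewrite -!MV; ring.
rewrite !D !eqxx mul1r mul0r addr0 mul0r add0r mul1r.
have [->|rj] := eqVneq r j => //.
by have [->|//] := eqVneq r j.+1.
Qed.

Lemma gen_mx_unit n M j : M \in unitmx -> (j.+1 < n)%N ->
  gen_mx n M j \in unitmx.
Proof. by move=> uM /(gen_mx_mulV uM) /mulmx1_unit[]. Qed.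

HB.instance Definition _ n := Monoid.isLaw.Build 'M[K]_n 1%:M (@mulmx K n n n)
  (@mulmxA K n n n n) (@mul1mx K n n) (@mulmx1 K n n).

(* The matrix of a braid: sigma_{j+1} is sent to [gen_mx n M j]. *)
Definition braid_mx (M : 'M[K]_2) (n : nat) (x : braid n) : 'M[K]_n :=
  braid_eval 1%:M mulmx (fun j : 'I_n.-1 => gen_mx n M j)
    (fun j : 'I_n.-1 => invmx (gen_mx n M j)) x.

(* The embedding of [K^n] as the last [n] copies in [K^n']. *)
Definition last_mx (n n' : nat) : 'M[K]_(n', n) :=
  \matrix_(r, c) ((r : nat) == n' - n + c)%N%:R.

Lemma last_mx_rowf n n' m (X : 'M[K]_(n, m)) c r : (n <= n')%N -> (r < n')%N ->
  rowf (last_mx n n' *m X) c r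
  = if (n' - n <= r)%N then rowf X c (r - (n' - n)) else 0.
Proof.
move=> le_n lt_r; pose r0 := Ordinal lt_r.
rewrite (rowfE _ c r0 : rowf _ c r = _) mxE; case: ifP => [le_r|gt_r]; last first.
  by rewrite big1 // => k _; rewrite mxE /= (_ : _ == _ = false) ?mul0r //; lia.
have lt_r' : (r - (n' - n) < n)%N by lia.
pose r1 := Ordinal lt_r'; rewrite (rowfE X c r1 : rowf X c _ = _).
rewrite (bigD1 r1) //= big1 ?addr0 => [|k k1].
  by rewrite mxE /= (_ : _ == _ = true) ?mul1r //; lia.
have kr : k != (r - (n' - n))%N :> nat by [].
by rewrite mxE /= (_ : _ == _ = false) ?mul0r //; lia.
Qed.

Lemma last_mx_id n : last_mx n n = 1%:M.
Proof. by apply/matrixP => r c; rewrite !mxE subnn. Qed.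

Lemma last_mx_comp n n' n'' : (n <= n')%N -> (n' <= n'')%N ->
  last_mx n' n'' *m last_mx n n' = last_mx n n''.
Proof.
move=> le_n le_n'; rewrite -[last_mx n n']mulmx1 -[last_mx n n'']mulmx1.
apply: rowf_inj => c r lt_r.
rewrite (last_mx_rowf (last_mx n n' *m _)) // [in RHS]last_mx_rowf //; last lia.
case: ifP => [le_r|gt_r]; last by rewrite ifF //; lia.
rewrite last_mx_rowf //; last lia.
have -> : (n' - n <= r - (n'' - n'))%N = (n'' - n <= r)%N by lia.
by case: ifP => // _; congr rowf; lia.
Qed.

Section Functoriality.
Variable M : 'M[K]_2.
Hypotheses (uM : M \in unitmx) (YB : yang_baxter M).

Let ltS n (j : 'I_n.-1) : (j.+1 < n)%N. Proof. by have := ltn_ord j; lia. Qed.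

Let genV n (j : 'I_n.-1) : gen_mx n M j *m invmx (gen_mx n M j) = 1%:M.
Proof. exact/mulmxV/gen_mx_unit. Qed.

Let genVl n (j : 'I_n.-1) : invmx (gen_mx n M j) *m gen_mx n M j = 1%:M.
Proof. exact/mulVmx/gen_mx_unit. Qed.

Let genF n (i j : 'I_n.-1) : (i.+1 < j)%N ->
  gen_mx n M i *m gen_mx n M j = gen_mx n M j *m gen_mx n M i.
Proof. by move=> ij; apply: gen_mx_far. Qed.

Let genB n (i j : 'I_n.-1) : j = i.+1 :> nat ->
  gen_mx n M i *m (gen_mx n M j *m gen_mx n M i)
  = gen_mx n M j *m (gen_mx n M i *m gen_mx n M j).
Proof. by move=> ij; have := ltS j; rewrite ij; apply: gen_mx_braid. Qed.

Lemma braid_mx1 n : braid_mx M (1 : braid n)%g = 1%:M.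
Proof. exact: (braid_eval1 (@genV n) (@genVl n) (@genF n) (@genB n)). Qed.

Lemma braid_mxM n (x y : braid n) :
  braid_mx M (x * y)%g = braid_mx M x *m braid_mx M y.
Proof. exact: (braid_evalM (@genV n) (@genVl n) (@genF n) (@genB n)). Qed.

Lemma braid_mx_sigma n i : (0 < i < n)%N ->
  braid_mx M (sigma n i) = gen_mx n M i.-1.
Proof.
case: i => // i lt_i; have lt_i' : (i < n.-1)%N by lia.
exact: (braid_eval_sigma (@genV n) (@genVl n) (@genF n) (@genB n) (Ordinal lt_i')).
Qed.

Lemma braid_mxV n (x : braid n) : braid_mx M x^-1%g *m braid_mx M x = 1%:M.
Proof. by rewrite -braid_mxM mulVg braid_mx1. Qed.

Lemma braid_mxVr n (x : braid n) : braid_mx M x *m braid_mx M x^-1%g = 1%:M.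
Proof. by rewrite -braid_mxM mulgV braid_mx1. Qed.

Lemma last_gen_mx n' n'' j : (n' <= n'')%N -> (j.+1 < n')%N ->
  last_mx n' n'' *m gen_mx n' M j = gen_mx n'' M (n'' - n' + j) *m last_mx n' n''.
Proof.
move=> le_n lt_j; rewrite -[last_mx n' n'' in RHS]mulmx1.
apply: rowf_inj => c r lt_r; rewrite last_mx_rowf // gen_mx_rowf //; last lia.
set a := (n'' - n')%N.
have E l : rowf (gen_mx n' M j) c l = gen_act M j (rowf 1%:M c) l.
  by rewrite gen_act_rowf // mulmx1.
rewrite E; set x := rowf 1%:M c.
have L l : (l < n'')%N -> rowf (last_mx n' n'' *m 1%:M) c l
    = if (a <= l)%N then x (l - a)%N else 0 by move=> lt_l; rewrite last_mx_rowf.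
rewrite /gen_act !L //; try lia.
have -> : (a + j - a = j)%N by lia.
have -> : ((a + j).+1 - a = j.+1)%N by lia.
have -> : (a <= a + j)%N by lia.
have -> : (a <= (a + j).+1)%N by lia.
case: leqP => [le_r|gt_r]; last by rewrite !ifF //; lia.
have -> : (r - a == j)%N = (r == a + j)%N by lia.
by have -> : (r - a == j.+1)%N = (r == (a + j).+1)%N by lia.
Qed.

Lemma gen_last_mx n n' j : (n <= n')%N -> (j.+1 < n' - n)%N ->
  gen_mx n' M j *m last_mx n n' = last_mx n n'.
Proof.
move=> le_n lt_j; rewrite -[last_mx n n']mulmx1.
apply: rowf_inj => c r lt_r; rewrite gen_mx_rowf //; last lia.
rewrite /gen_act !last_mx_rowf //; try lia.
have [->|_] := eqVneq r j; first by rewrite !ifF ?mulr0 ?addr0 //; lia.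
have [->|//] := eqVneq r j.+1; first by rewrite !ifF ?mulr0 ?addr0 //; lia.
Qed.

Lemma last_braid_mx n' n'' (x : braid n') : (n' <= n'')%N ->
  last_mx n' n'' *m braid_mx M x
  = braid_mx M (strands (n'' - n') n' n'' x) *m last_mx n' n''.
Proof.
move=> le_n; have le_a : (n'' - n' + n' <= n'')%N by lia.
have G i (lt_i : (0 < i < n')%N) :
    last_mx n' n'' *m braid_mx M (sigma n' i)
    = braid_mx M (sigma n'' (n'' - n' + i)) *m last_mx n' n''.
  rewrite !braid_mx_sigma //; try lia.
  by rewrite last_gen_mx //; [congr (gen_mx _ _ _ *m _)|]; lia.
elim/braid_ind: x => [|i x lt_i IHx|i x lt_i IHx].
- by rewrite strands1 // !braid_mx1 mulmx1 mul1mx.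
- by rewrite strandsM // strands_sigma // !braid_mxM mulmxA G // -mulmxA IHx mulmxA.
rewrite strandsM // strandsV // strands_sigma // !braid_mxM.
set A := braid_mx M (sigma n'' _)^-1%g; set B := braid_mx M (sigma n' i)^-1%g.
have -> : last_mx n' n'' *m (B *m braid_mx M x)
    = A *m (braid_mx M (sigma n'' (n'' - n' + i)) *m last_mx n' n'')
      *m (B *m braid_mx M x).
  by rewrite (mulmxA A) braid_mxV mul1mx.
rewrite -G // -mulmxA -(mulmxA (last_mx _ _)) (mulmxA (braid_mx M (sigma _ _))).
by rewrite braid_mxVr mul1mx IHx mulmxA.
Qed.

Lemma braid_last_mx n n' (x : braid (n' - n)) : (n <= n')%N ->
  braid_mx M (strands 0 (n' - n) n' x) *m last_mx n n' = last_mx n n'.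
Proof.
move=> le_n; have le_0 : (0 + (n' - n) <= n')%N by lia.
have G i (lt_i : (0 < i < n' - n)%N) :
    braid_mx M (sigma n' i) *m last_mx n n' = last_mx n n'.
  by rewrite braid_mx_sigma ?gen_last_mx //; lia.
elim/braid_ind: x => [|i x lt_i IHx|i x lt_i IHx].
- by rewrite strands1 // braid_mx1 mul1mx.
- by rewrite strandsM // strands_sigma // braid_mxM -mulmxA IHx G.
rewrite strandsM // strandsV // strands_sigma // braid_mxM -mulmxA IHx.
by rewrite add0n -{1}(G i lt_i) mulmxA braid_mxV mul1mx.
Qed.

(* [[n' - n, f] = f o [n' - n, id]] acts on column vectors. *)
Definition umx n n' (f : uhom n n') : 'M[K]_(n', n) :=
  braid_mx M (urepr f) *m last_mx n n'.

Lemma umxE n n' (le_n : (n <= n')%N) (f : braid n') :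
  umx (uclass le_n f) = braid_mx M f *m last_mx n n'.
Proof.
rewrite /umx; have [g ->] := urepr_class le_n f.
by rewrite braid_mxM -mulmxA braid_last_mx.
Qed.

Lemma umx1 n : umx (uid n) = 1%:M.
Proof. by rewrite umxE braid_mx1 mul1mx last_mx_id. Qed.

Lemma umxM n n' n'' (g : uhom n' n'') (f : uhom n n') :
  umx (ucomp g f) = umx g *m umx f.
Proof.
elim/uhomW: g => le_g g; elim/uhomW: f => le_f f.
rewrite ucompE !umxE braid_mxM -(last_mx_comp le_f le_g) -!mulmxA.
by congr (_ *m _); rewrite !mulmxA last_braid_mx.
Qed.

Definition mxfun_mor n n' (f : uhom n n') : {linear 'cV[K]_n -> 'cV[K]_n'} :=
  mulmx (umx f).

Lemma mxfun1 n : mxfun_mor (uid n) = mod_id 'cV[K]_n.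
Proof. by apply: linear_eqP => x; rewrite /= umx1 mul1mx. Qed.

Lemma mxfunM n n' n'' (g : uhom n' n'') (f : uhom n n') :
  mxfun_mor (ucomp g f) = mod_comp (mxfun_mor g) (mxfun_mor f).
Proof. by apply: linear_eqP => x; rewrite /= umxM mulmxA. Qed.

(* Objects are sent to spaces of column vectors, so that matrices act on the
   left and composition of braids is sent to the product of matrices. *)
Definition mxfun : functor Ubeta (Mod K) :=
  @Functor Ubeta (Mod K) (fun n : nat => 'cV[K]_n) mxfun_mor mxfun1 mxfunM.

Lemma mxfun_sigma n i (x : 'cV[K]_n) : (0 < i < n)%N ->
  fmor mxfun (uclass (leqnn n) (sigma n i)) x = gen_mx n M i.-1 *m x.
Proof. by move=> lt_i; rewrite /= umxE last_mx_id mulmx1 braid_mx_sigma. Qed.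

Lemma mxfun_last n n' (le_n : (n <= n')%N) (x : 'cV[K]_n) :
  fmor mxfun (uclass le_n 1%g) x = last_mx n n' *m x.
Proof. by rewrite /= umxE braid_mx1 mul1mx. Qed.

End Functoriality.

Section BurauTYM.
Variables (t : K) (ut : t \is a GRing.unit).

Definition burau_mx : 'M[K]_2 := mx2 0 t 1 (1 - t).
Definition tym_mx : 'M[K]_2 := mx2 0 t 1 0.

Lemma mx2_unit d : mx2 0 t 1 d \in unitmx.
Proof.
suff /mulmx1_unit[] : mx2 0 t 1 d *m mx2 (- (t^-1 * d)) 1 t^-1 0 = 1%:M by [].
by apply/matrixP => -[[|[|//]] r] [[|[|//]] c];
  rewrite !mxE big_ord_recl big_ord1 !mxE /= ?divrr //; ring.
Qed.

Lemma mx2_yang_baxter d : d = 0 \/ d = 1 - t -> yang_baxter (mx2 0 t 1 d).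
Proof.
move=> dt x [|[|[|r]]]; rewrite /gen_act /= ?mxE //=;
  case: dt => ->; ring.
Qed.

Definition burau : functor Ubeta (Mod K) :=
  mxfun (mx2_unit (1 - t)) (mx2_yang_baxter (or_intror erefl)).
Definition tym : functor Ubeta (Mod K) :=
  mxfun (mx2_unit 0) (mx2_yang_baxter (or_introl erefl)).

End BurauTYM.

End MatrixFunctor.

Definition Bur (R : realType) : functor Ubeta (Mod (laurent R[i])) :=
  burau (laurentX_unit R[i]).

Definition TYM (R : realType) : functor Ubeta (Mod (laurent R[i])) :=
  tym (laurentX_unit R[i]).

(* Main.v *)
(* Both functors come from a matrix [M] with first column [(0, 1)], i.e.
   sigma_i sends the basis vector e_i to e_(i+1).  Hence the braiding b_(k,l)
   sends e_p to e_(l+p) for p <= k, and [id_k natural iota_l natural id_n] acts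
   on K^(k+n) by inserting [l] zero coordinates after the first [k] ones.
   Since [delta_k F n] is K^(k+n) modulo its last [n] copies of K, the map
   [i_l] is an isomorphism on [delta_k F], which is thus very strong
   polynomial of degree 0. *)

Require Import Defs.
From mathcomp Require Import all_boot all_order all_algebra reals.
From mathcomp Require Import zify.

Set Implicit Arguments.
Unset Strict Implicit.
Unset Printing Implicit Defensive.
Import GRing.Theory.
Local Open Scope ring_scope.

Section Columns.
Variable K : comUnitRingType.

(** Entries are indexed by [nat] rather than by ordinals, so that [gen_act] and coordinate shifts
    apply without casts between sizes such as [k + n] and [k + (l + n)]. *)
Definition seq_col (n : nat) (y : nat -> K) : 'cV[K]_n := \col_r y r.

Lemma rowf_seq_col n y c r : (r < n)%N -> rowf (seq_col n y) c r = y r.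
Proof.
by move=> lt_r; rewrite (rowfE _ c (Ordinal lt_r) : rowf _ c r = _) mxE.
Qed.

Lemma eq_seq_col n (y z : nat -> K) :
  (forall r, (r < n)%N -> y r = z r) -> seq_col n y = seq_col n z.
Proof. by move=> yz; apply/colP => r; rewrite !mxE yz. Qed.

Lemma gen_mx_seq_col n (M : 'M[K]_2) j y : (j.+1 < n)%N ->
  gen_mx n M j *m seq_col n y = seq_col n (gen_act M j y).
Proof.
move=> lt_j; apply: rowf_inj => c r lt_r.
by rewrite gen_mx_rowf // rowf_seq_col // /gen_act !rowf_seq_col //; lia.
Qed.

Lemma last_mx_seq_col n n' (x : 'cV[K]_n) : (n <= n')%N ->
  last_mx K n n' *m x
  = seq_col n' (fun r => if (n' - n <= r)%N then rowf x 0 (r - (n' - n)) else 0).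
Proof.
move=> le_n; apply: rowf_inj => c r lt_r.
by rewrite last_mx_rowf // rowf_seq_col // (ord1 c).
Qed.

Lemma last_mx_inj n n' (x : 'cV[K]_n) : (n <= n')%N ->
  last_mx K n n' *m x = 0 -> x = 0.
Proof.
move=> le_n x0; apply: rowf_inj => c r lt_r.
have := last_mx_rowf x c le_n (_ : (n' - n + r < n')%N).
rewrite x0 leq_addr addKn => <- //; last lia.
by rewrite /rowf; case: insub => [?|]; case: insub => [?|]; rewrite ?mxE.
Qed.

Lemma last_mx_im n k (x : 'cV[K]_(k + n)) :
  (exists y, x = last_mx K n (k + n) *m y) <->
  (forall r, (r < k)%N -> rowf x 0 r = 0).
Proof.
split=> [[y ->] r lt_r|x0].
  rewrite last_mx_rowf; try lia.
  by rewrite ifF //; lia.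
exists (seq_col n (fun r => rowf x 0 (k + r))).
rewrite last_mx_seq_col ?leq_addl // addnK.
apply: rowf_inj => c r lt_r; rewrite (ord1 c) rowf_seq_col //.
case: leqP => [le_r|/x0 //].
by rewrite rowf_seq_col; [rewrite subnKC | lia].
Qed.

Lemma rowf_sub m n (X Y : 'M[K]_(n, m)) c r :
  rowf (X - Y) c r = rowf X c r - rowf Y c r.
Proof. by rewrite /rowf; case: insub => [?|]; rewrite ?mxE ?subr0. Qed.

Definition insert_zeros (l i : nat) (x : nat -> K) (r : nat) : K :=
  if (r < i)%N then x r else if (r < i + l)%N then 0 else x (r - l)%N.

End Columns.

Section FirstColumn.
Variables (K : comUnitRingType) (M : 'M[K]_2).
Hypotheses (uM : M \in unitmx) (YB : yang_baxter M).
Hypotheses (M00 : M 0 0 = 0) (M10 : M 1 0 = 1).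

Let F := mxfun uM YB.

(** The second column of [M] only meets the zero entry [y j.+1], so the first column decides the
    action; this treats Burau and Tong-Yang-Ma at once. *)
Lemma gen_act_shift1 j (y : nat -> K) r : y j.+1 = 0 ->
  gen_act M j y r
  = if r == j then 0 else if r == j.+1 then y j else y r.
Proof.
by move=> y0; rewrite /gen_act y0 M00 M10 !mulr0 mul0r mul1r !addr0.
Qed.

(** By induction on [m]: each generator pushes the value [y j] one position further into the block
    of zeros. *)
Lemma sigma_run_seq_col N j m (y : nat -> K) : (j + m < N)%N ->
  (forall r, (j < r <= j + m)%N -> y r = 0) ->
  braid_mx M (sigma_run N j m) *m seq_col N y
  = seq_col N (fun r => if (r < j)%N || (j + m < r)%N then y r
                        else if r == (j + m)%N then y j else 0).
Proof.
elim: m => [|m IHm] lt_N y0.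
  rewrite /sigma_run big_ord0 braid_mx1 // mul1mx addn0.
  by apply: eq_seq_col => r _; case: ltngtP => // ->.
rewrite sigma_runS braid_mxM // -mulmxA IHm; [|lia|by move=> r ?; apply: y0; lia].
rewrite braid_mx_sigma //; last lia.
rewrite gen_mx_seq_col; last lia.
(* Position [j + m + 1] has not been reached yet, so it still holds the zero of [y]. *)
apply: eq_seq_col => r lt_r; rewrite gen_act_shift1; last first.
  by rewrite ifT ?y0 //; lia.
have -> : (m.+1 + j).-1 = (j + m)%N by lia.
have -> : (j + m < j)%N || (j + m < j + m)%N = false by lia.
rewrite eqxx addnS.
case: (eqVneq r (j + m)%N) => [r_jm|r_jm]; first by rewrite !ifF //; lia.
case: (eqVneq r (j + m).+1) => [r_jmS|r_jmS]; first by rewrite ifF //; lia.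
case: ifP => [r_out|r_in]; first by rewrite ifT //; lia.
by rewrite ifF //; lia.
Qed.

(** Entry [i] jumps over the [l] zeros to its right, so the block of zeros moves one place left. *)
Lemma sigma_run_insert_zeros N i l (x : nat -> K) : (i + l < N)%N ->
  braid_mx M (sigma_run N i l) *m seq_col N (insert_zeros l i.+1 x)
  = seq_col N (insert_zeros l i x).
Proof.
move=> lt_N; rewrite sigma_run_seq_col // => [|r lt_r]; last first.
  by rewrite /insert_zeros ifF ?ifT //; lia.
apply: eq_seq_col => r lt_r; rewrite /insert_zeros ltnSn.
case: (ltnP r i) => [lt_i|le_i] /=; first by rewrite ifT //; lia.
have [lt_r_il|gt_r_il|->] := ltngtP r (i + l).
- by [].
- by rewrite !ifF //; lia.
by rewrite addnK.
Qed.

Lemma braiding_insert_zeros N k l (x : nat -> K) : (k + l <= N)%N ->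
  braid_mx M (\prod_(j < k) sigma_run N j l)%g
    *m seq_col N (insert_zeros l k x)
  = seq_col N (insert_zeros l 0 x).
Proof.
elim: k => [|k IHk] le_N; first by rewrite big_ord0 braid_mx1 // mul1mx.
(* The last factor of the product acts first and moves the zeros from position [k.+1] to [k]. *)
rewrite big_ord_recr /= braid_mxM // -mulmxA sigma_run_insert_zeros; last lia.
by apply: IHk; lia.
Qed.

Lemma utensor_iota_insert_zeros k l n (x : 'cV[K]_(k + n)) :
  umx M (utensor (uid k) (utensor (iota_mor l) (uid n))) *m x
  = seq_col (k + (l + n)) (insert_zeros l k (rowf x 0)).
Proof.
have le_n : (n <= l + n)%N by rewrite leq_addl.
have le_kn : (k + n <= k + (l + n))%N by rewrite leq_add2l.
rewrite utensor_iotaE (utensor_idE le_n le_kn) umxE // -mulmxA.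
rewrite [strands k _ _ _]strands1 // mul1g addnK.
rewrite last_mx_seq_col //; set N := (k + (l + n))%N.
have -> : (N - (k + n) = l)%N by lia.
have E : seq_col N (fun r => if (l <= r)%N then rowf x 0 (r - l) else 0)
    = seq_col N (insert_zeros l 0 (rowf x 0)).
  by apply: eq_seq_col => r _; rewrite /insert_zeros ltn0 add0n; case: leqP.
rewrite E strands_braiding; last lia.
(* The column is now the braiding applied to the claimed result, and the inverse braiding from
   [utensor] cancels it. *)
rewrite -(@braiding_insert_zeros N k l); last lia.
by rewrite mulmxA braid_mxV // mul1mx.
Qed.

Lemma mxfun_iE k n (x : 'cV[K]_n) :
  i_trans k F n x = last_mx K n (k + n) *m x.
Proof.
by rewrite /= (utensor_iotaE (leq_addl k n)) umxE // braid_mx1 // mul1mx.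
Qed.

(** The image of [i_k] is the last [n] copies of [K], so the first [k] coordinates identify
    [delta k F n] with [K^k] for every [n]. *)
Lemma mxfun_coker_eq k n (x y : 'cV[K]_(k + n)) :
  coker_proj (i_trans k F n) x = coker_proj (i_trans k F n) y <->
  (forall r, (r < k)%N -> rowf x 0 r = rowf y 0 r).
Proof.
split=> [/eqP/coker_projP[u xy] r lt_r|xy].
  apply/eqP; rewrite -subr_eq0 -rowf_sub; apply/eqP.
  by move: r lt_r; apply/last_mx_im; exists u; rewrite -mxfun_iE.
apply/eqP/coker_projP; have [|u xyE] := (last_mx_im (x - y)).2.
  by move=> r lt_r; rewrite rowf_sub xy // subrr.
by exists u; rewrite mxfun_iE.
Qed.

Lemma mxfun_delta_iE k l n (x : 'cV[K]_(k + n)) :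
  i_trans l (delta k F) n (coker_proj (i_trans k F n) x)
  = coker_proj (i_trans k F (l + n)%N)
      (seq_col (k + (l + n)) (insert_zeros l k (rowf x 0))).
Proof. by rewrite -utensor_iota_insert_zeros; apply: fcoker_funE. Qed.

Lemma mxfun_kappa0 k : is_zero (kappa k F).
Proof.
move=> n x; apply: val_inj; have := valP x; rewrite inE => /eqP.
by rewrite mxfun_iE => /last_mx_inj; apply; rewrite leq_addl.
Qed.

(** Inserting zeros after position [k] keeps the first [k] coordinates, which determine the class;
    hence [i_l] is injective. *)
Lemma mxfun_delta_kappa0 k l : is_zero (kappa l (delta k F)).
Proof.
move=> n x; apply: val_inj; have := valP x; rewrite inE => /eqP.
rewrite -(coker_proj_repr (val x)); set y := repr _.
rewrite mxfun_delta_iE -(linear0 (coker_proj (i_trans k F (l + n)%N))).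
move=> /mxfun_coker_eq y0.
rewrite -[RHS](linear0 (coker_proj (i_trans k F n))).
apply/mxfun_coker_eq => r lt_r; have := y0 r lt_r.
rewrite rowf_seq_col /insert_zeros ?lt_r => [->|]; last lia.
by rewrite /rowf; case: insub => [?|]; case: insub => [?|]; rewrite ?mxE.
Qed.

Lemma mxfun_delta_delta0 k l : is_zero (delta l (delta k F)).
Proof.
(* An element of a cokernel of a cokernel: two choices of representatives lead to a vector. *)
move=> n q; rewrite -(coker_proj_repr q) -(coker_proj_repr (repr q)).
set y := repr (repr q); rewrite -[RHS](linear0 (coker_proj _)).
apply/eqP/coker_projP; rewrite subr0.
(* Truncating [y] to [k + n] entries keeps the first [k], so its class is a preimage under [i_l]. *)
exists (coker_proj (i_trans k F n) (seq_col (k + n) (rowf y 0))).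
rewrite mxfun_delta_iE; apply/mxfun_coker_eq => r lt_r.
by rewrite rowf_seq_col /insert_zeros ?lt_r ?rowf_seq_col //; lia.
Qed.

Lemma mxfun_delta1_neq0 : ~ is_zero (delta 1 F).
Proof.
move=> /(_ 0%N (coker_proj (i_trans 1 F 0%N) (seq_col 1 (fun=> 1)))).
rewrite -[RHS](linear0 (coker_proj _)) => /mxfun_coker_eq/(_ 0%N isT).
by rewrite rowf_seq_col // (rowfE _ 0 ord0) mxE => /eqP; rewrite oner_eq0.
Qed.

Lemma mxfun_very_strong_pol1 : very_strong_pol_of_degree 1 F.
Proof.
(* Only degree 0 must be excluded, and it would force [delta 1 F] to vanish. *)
split=> [|[|d] // [/(_ 1%N) d0 _]]; last by case: mxfun_delta1_neq0.
split=> [k l|k]; first exact: mxfun_delta_delta0.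
split; first exact: mxfun_kappa0.
split=> [l|l]; first exact: mxfun_delta_delta0.
by split; [exact: mxfun_delta_kappa0 | exact: mxfun_delta_delta0].
Qed.

End FirstColumn.

Theorem proposition3p25 (R : realType) :
  very_strong_pol_of_degree 1 (Bur R) /\ very_strong_pol_of_degree 1 (TYM R).
(* What remains is that both matrices have first column [(0, 1)]. *)
Proof. by split; apply: mxfun_very_strong_pol1; rewrite mxE. Qed.
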